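(* Let $a_0,a_1$ be real numbers, and suppose that the complex Hessian equation $$c_n\sigma_{n+1}(\partial\bar\partial u)+c_{n-1}\sigma_n(\partial\bar\partial u)+\dots+c_0\sigma_1(\partial\bar\partial u)+c_{-1}=0$$ (respectively the real Hessian equation with the same real coefficients, in which $\partial\bar\partial u$ is replaced by $\nabla^2 f$) is of recursive type $(a_0,a_1)$, that is, $c_{k-1}=a_1c_k-a_0c_{k+1}$ for $k=1,\dots,n-1$. Let $F(p_1,\dots,p_n)=\sum_{k=0}^n c_k\sigma_k(p)$ and $G(p_1,\dots,p_n)=\sum_{k=0}^n c_{k-1}\sigma_k(p)$. Then the associated second-order ODE system $$\frac{p_i''}{2}\,F(p_1,\dots,p_n)=(p_i')^2\,\frac{\partial F}{\partial p_i}(p_1,\dots,p_n)\quad(i=1,\dots,n),\qquad r''\,F(p_1,\dots,p_n)=-G(p_1,\dots,p_n)$$ is completely integrable. In fact, for solutions with $p_i'\neq 0$ for all $i$ and $F(p_1,\dots,p_n)\neq 0$, denote $$\xi_i=\frac{p_i^2+a_1p_i+a_0}{p_i'},\qquad i=1,\dots,n.$$ Then $$\frac{F^2}{\prod_{i=1}^n p_i'}\qquad\text{and}\qquad \xi_i-\xi_1,\quad i=2,\dots,n,$$ are first integrals of the system. Moreover, $\xi_1,\dots,\xi_n$ satisfy the ODE system $$(\xi_i')^2=k_1+k_2\prod_{j=1}^n\xi_j,\qquad i=1,\dots,n,$$ for explicit real constants $k_1,k_2$ depending only on $a_0,a_1,c_{n-1}$ and $c_n$.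
   Context: Here $c_{-1},c_0,\dots,c_n$ are real constants. The complex Hessian equation is for a real-valued $C^2$ function $u$ on a domain in $\mathbb{C}^{n+1}$, with $\sigma_k(\partial\bar\partial u)$ the $k$-th symmetric function of the complex Hessian of $u$. The real Hessian equation is for a function $f$ on a domain in $\mathbb{R}^{n+1}$, with $\sigma_k(\nabla^2 f)$ the $k$-th symmetric function of the real Hessian of $f$. $\sigma_k(p)$ denotes the $k$-th elementary symmetric polynomial of $p_1,\dots,p_n$ ($\sigma_0=1$). The unknowns $p_1,\dots,p_n,r$ of the ODE system are real-valued $C^2$ functions of one real variable $s$, and primes denote $d/ds$. A first integral is a function of the $p_i$ and $p_i'$ that is constant along every solution. ''Completely integrable'' means in particular that the system admits enough first integrals to reduce the dynamics to quadratures.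
   Formalization: The constant k_2 is an explicit function of a_0, a_1, c_{n-1}, c_n divided by the value of the first integral F^2/prod p_i' along the solution; as literally stated the claim fails, e.g. n=1, c_1=0, c_0=1, p=ls gives k_2=4l. *)

(* Defs.v *)
From HB Require Import structures.
From mathcomp Require Import all_boot all_order all_algebra.
From mathcomp Require Import all_classical all_reals all_analysis.
From mathcomp Require Import complex.

Set Implicit Arguments.
Unset Strict Implicit.
Unset Printing Implicit Defensive.

Import Order.TTheory GRing.Theory Num.Theory.
Import numFieldNormedType.Exports.

Local Open Scope classical_set_scope.
Local Open Scope ring_scope.

(* C^2 on an open set D, through directional derivatives: in finite dimension
   this is the usual class, and for V = R it says that f, f', f'' exist and
   are continuous on D. *)
Definition C2_on (R : realType) (V : normedModType R) (D : set V)
    (f : V -> R) : Prop :=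
  forall x, D x ->
    {for x, continuous f} /\
    forall v w : V,
      [/\ derivable f x v, derivable ('D_v f) x w,
          {for x, continuous ('D_v f)} &
          {for x, continuous ('D_w ('D_v f))}].

Definition sigma (R : realType) (n k : nat) (p : 'rV[R]_n) : R :=
  \sum_(A : {set 'I_n} | #|A| == k) \prod_(i in A) p 0 i.

(* The k-th elementary symmetric function of the eigenvalues, read off from
   det (X - M) = \sum_k (-1)^k sigma_k(M) X^(m-k); meaningful for k <= m. *)
Definition sigma_mx (K : comNzRingType) (m k : nat) (M : 'M[K]_m) : K :=
  (-1) ^+ k * (char_poly M)`_(m - k).

Variant hessian_kind := ComplexHessian | RealHessian.

(* C^(n+1) is encoded as R^(n+1) * R^(n+1), a pair (x, y) standing for
   z = x + i y. *)
Definition hessian_space (R : realType) (n : nat) (kd : hessian_kind) :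
    normedModType R :=
  match kd with
  | ComplexHessian => ('rV[R]_n.+1 * 'rV[R]_n.+1)%type
  | RealHessian => 'rV[R]_n.+1
  end.

(* Entries d^2 u / dz_j d(conj z_k), where d/dz = (d/dx - i d/dy) / 2 and
   d/d(conj z) = (d/dx + i d/dy) / 2. *)
Definition complex_hessian (R : realType) (n : nat)
    (u : 'rV[R]_n.+1 * 'rV[R]_n.+1 -> R) (z : 'rV[R]_n.+1 * 'rV[R]_n.+1) :
    'M[R[i]]_n.+1 :=
  let ex (j : 'I_n.+1) := (delta_mx 0 j : 'rV[R]_n.+1, 0 : 'rV[R]_n.+1) in
  let ey (j : 'I_n.+1) := (0 : 'rV[R]_n.+1, delta_mx 0 j : 'rV[R]_n.+1) in
  \matrix_(j, k)
    Complex (('D_(ex j) ('D_(ex k) u) z + 'D_(ey j) ('D_(ey k) u) z) / 4)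
            (('D_(ex j) ('D_(ey k) u) z - 'D_(ey j) ('D_(ex k) u) z) / 4).

Definition real_hessian (R : realType) (n : nat) (f : 'rV[R]_n.+1 -> R)
    (x : 'rV[R]_n.+1) : 'M[R]_n.+1 :=
  \matrix_(j, k)
    'D_(delta_mx 0 j : 'rV[R]_n.+1) ('D_(delta_mx 0 k : 'rV[R]_n.+1) f) x.

Definition sigma_hessian (R : realType) (n : nat) (kd : hessian_kind)
    (k : nat) : (hessian_space R n kd -> R) -> hessian_space R n kd -> R[i] :=
  match kd with
  | ComplexHessian => fun u z => sigma_mx k (complex_hessian u z)
  | RealHessian => fun f x => Complex (sigma_mx k (real_hessian f x)) 0
  end.

(* hess_coef k is the constant c_k; only -1 <= k <= n matters. *)
Record hessian_equation (R : realType) (n : nat) := HessianEquation {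
  hess_kind : hessian_kind;
  hess_coef : int -> R
}.

Definition hessian_solution (R : realType) (n : nat)
    (E : hessian_equation R n) (D : set (hessian_space R n (hess_kind E)))
    (u : hessian_space R n (hess_kind E) -> R) : Prop :=
  [/\ open D, connected D, C2_on D u &
      forall z, D z ->
        \sum_(k < n.+2)
          Complex (hess_coef E (k%:Z - 1)) 0 * sigma_hessian k u z = 0].

Definition recursive_type (R : realType) (n : nat) (E : hessian_equation R n)
    (a0 a1 : R) : Prop :=
  forall k : nat, (1 <= k <= n.-1)%N ->
    hess_coef E (k%:Z - 1)
      = a1 * hess_coef E k%:Z - a0 * hess_coef E (k%:Z + 1).

Definition hess_F (R : realType) (n : nat) (E : hessian_equation R n)
    (p : 'rV[R]_n) : R :=
  \sum_(k < n.+1) hess_coef E k%:Z * sigma k p.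

Definition hess_G (R : realType) (n : nat) (E : hessian_equation R n)
    (p : 'rV[R]_n) : R :=
  \sum_(k < n.+1) hess_coef E (k%:Z - 1) * sigma k p.

(* A point (p, p') of the phase space. *)
Definition phase (R : realType) (n : nat) := ('rV[R]_n * 'rV[R]_n)%type.

Definition state (R : realType) (n : nat) (p : 'I_n -> R -> R) (s : R) :
    phase R n :=
  (\row_i p i s, \row_i derive1 (p i) s).

Definition ode_solution (R : realType) (n : nat) (E : hessian_equation R n)
    (D : set R) (p : 'I_n -> R -> R) (r : R -> R) : Prop :=
  [/\ open D, is_interval D,
      (forall i, C2_on D (p i)) /\ C2_on D r &
      forall s, D s ->
        let ps := \row_i p i s in
        (forall i : 'I_n,
           derive1n 2 (p i) s / 2 * hess_F E ps
             = derive1 (p i) s ^+ 2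
               * 'D_(delta_mx 0 i : 'rV[R]_n) (hess_F E) ps) /\
        derive1n 2 r s * hess_F E ps = - hess_G E ps].

Definition regular (R : realType) (n : nat) (E : hessian_equation R n)
    (z : phase R n) : Prop :=
  (forall i, z.2 0 i != 0) /\ hess_F E z.1 != 0.

Definition regular_solution (R : realType) (n : nat)
    (E : hessian_equation R n) (D : set R) (p : 'I_n -> R -> R)
    (r : R -> R) : Prop :=
  ode_solution E D p r /\ forall s, D s -> regular E (state p s).

Definition first_integral (R : realType) (n : nat) (E : hessian_equation R n)
    (Phi : phase R n -> R) : Prop :=
  forall D p r, regular_solution E D p r ->
    forall s t, D s -> D t -> Phi (state p s) = Phi (state p t).

(* The differentials of the Phi k are linearly independent on a dense subset
   of the regular phase space. *)
Definition functionally_independent (R : realType) (n m : nat)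
    (E : hessian_equation R n) (Phi : 'I_m -> phase R n -> R) : Prop :=
  forall (z : phase R n) (e : R), regular E z -> 0 < e ->
    exists z' : phase R n,
      [/\ regular E z', ball z e z',
          forall k, differentiable (Phi k) z' &
          forall lam : 'I_m -> R,
            (forall w : phase R n, \sum_k lam k * 'D_w (Phi k) z' = 0) ->
            forall k, lam k = 0].

(* Functions on ]a, b[ obtained from the constants and the variable by
   finitely many algebraic operations, inversions of functions and
   quadratures (primitives of known functions).  Only the values on ]a, b[
   are constrained. *)
Inductive by_quadratures (R : realType) : R -> R -> (R -> R) -> Prop :=
| bq_cst a b c : by_quadratures a b (fun _ => c)
| bq_id a b : by_quadratures a b (fun x => x)
| bq_add a b f g : by_quadratures a b f -> by_quadratures a b g ->
    by_quadratures a b (fun x => f x + g x)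
| bq_mul a b f g : by_quadratures a b f -> by_quadratures a b g ->
    by_quadratures a b (fun x => f x * g x)
| bq_inv a b f : by_quadratures a b f ->
    (forall x, a < x < b -> f x != 0) ->
    by_quadratures a b (fun x => (f x)^-1)
| bq_primitive a b f g : by_quadratures a b g ->
    (forall x, a < x < b -> is_derive x (1 : R) f (g x)) ->
    by_quadratures a b f
| bq_inverse a b c d f g h :
    by_quadratures c d g ->
    (forall x y, c < x < d -> c < y < d -> g x = g y -> x = y) ->
    by_quadratures a b h ->
    (forall x, a < x < b -> c < f x < d /\ g (f x) = h x) ->
    by_quadratures a b f.

(* There are as many independent first integrals as degrees of freedom, and
   the regular solutions are obtained by quadratures near a dense set of
   times: the formulas are allowed to break down at isolated points, such as
   the turning points of (x')^2 = P(x). *)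
Definition completely_integrable (R : realType) (n : nat)
    (E : hessian_equation R n) : Prop :=
  (exists Phi : 'I_n -> phase R n -> R,
     (forall k, first_integral E (Phi k)) /\ functionally_independent E Phi) /\
  (forall D p r, regular_solution E D p r ->
     forall (s e : R), D s -> 0 < e ->
       exists a b : R,
         [/\ a < b, (forall x, a < x < b -> D x /\ `|x - s| < e),
             forall i, by_quadratures a b (p i) & by_quadratures a b r]).

Definition F2_over_prod (R : realType) (n : nat) (E : hessian_equation R n)
    (z : phase R n) : R :=
  hess_F E z.1 ^+ 2 / \prod_i z.2 0 i.

Definition xi (R : realType) (n : nat) (a0 a1 : R) (i : 'I_n)
    (z : phase R n) : R :=
  (z.1 0 i ^+ 2 + a1 * z.1 0 i + a0) / z.2 0 i.

Definition k1 (R : realType) (a0 a1 : R) : R := a1 ^+ 2 - 4 * a0.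

(* The product of the xi_j scales under s |-> l s while (xi_i')^2 does not, so
   k2 is the constant for solutions on which F^2 / prod p_i' = 1; in general
   it has to be divided by the value of this first integral.  Here b stands
   for c_(n-1) and c for c_n. *)
Definition k2 (R : realType) (a0 a1 b c : R) : R :=
  4 * (b ^+ 2 - a1 * b * c + a0 * c ^+ 2).

(* Main.v *)
(* F is affine in each p_i: F = A + p_i B, where A and B are the sums of
   c_k sigma_k and c_(k+1) sigma_k over the other variables.  The equations of
   motion give at once that F^2 / prod p_i' is constant and that
   F xi_i' = (2 p_i + a_1) A - (a_1 p_i + 2 a_0) B.  Splitting off a second
   variable p_k, the recursion on the c_k makes this expression symmetric in
   p_i and p_k, so xi_i' does not depend on i.  Moreover
     (F xi_i')^2 - (a_1^2 - 4 a_0) F^2 = 4 Q(p_i) (A^2 - a_1 A B + a_0 B^2)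
   with Q(u) = u^2 + a_1 u + a_0, and the recursion makes the last factor
   multiplicative: each variable removed from A and B contributes Q(p_k).
   Hence the equation (xi_i')^2 = k_1 + const * prod (xi_1 + const_j), which is
   solved by one quadrature where xi_1' does not vanish; p_i then follows by
   separating the variables in p_i' / Q(p_i) = 1 / xi_i, and r by integrating
   - G / F twice. *)

Require Import Defs.
From HB Require Import structures.
From mathcomp Require Import all_boot all_order all_algebra.
From mathcomp Require Import all_classical all_reals all_analysis.
From mathcomp Require Import ring lra.
Import Order.TTheory GRing.Theory Num.Theory.
Import numFieldNormedType.Exports.
Local Open Scope classical_set_scope.
Local Open Scope ring_scope.

Set Implicit Arguments.
Unset Strict Implicit.
Unset Printing Implicit Defensive.

(** * Shifted sums of elementary symmetric functions *)

(** Letting variables enter one at a time reduces identities about [sigsum] to [sigsumU1]. *)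
Lemma set_addone_ind (T : finType) (P : {set T} -> Prop) :
  P finset.set0 ->
  (forall (i : T) (S : {set T}), i \notin S -> P S -> P (i |: S)%SET) ->
  forall S, P S.
Proof.
move=> P0 PU S; have [m] := ubnP #|S|; elim: m S => // m IH S.
have [->|[i iS]] := set_0Vmem S; first by move=> _; exact: P0.
rewrite -(finset.setD1K iS) cardsU1 !inE eqxx /= add1n ltnS => Sm.
by apply: PU; [rewrite !inE eqxx|exact: IH].
Qed.

(* F is [sigsum c 0 setT] and its derivative along p_i is
   [sigsum c 1 (setT :\ i)]: removing a variable shifts the coefficients. *)
Definition sigsum (K : comNzRingType) (n : nat) (c : nat -> K) (j : nat)
    (S : {set 'I_n}) (x : 'I_n -> K) : K :=
  \sum_(A : {set 'I_n} | A \subset S) c (j + #|A|)%N * \prod_(i in A) x i.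

Section SigsumAlgebra.
Variables (K : comNzRingType) (n : nat) (c : nat -> K) (x : 'I_n -> K).
Implicit Types (S : {set 'I_n}).

Lemma sigsum0 j : sigsum c j finset.set0 x = c j.
Proof.
rewrite /sigsum (big_pred1 finset.set0); last by move=> A; rewrite /= finset.subset0.
by rewrite cards0 addn0 big_set0 mulr1.
Qed.

(** Subsets are split by whether they contain [i]; those that do are [i |: A], with one more
    element, hence the shift to [j.+1]. *)
Lemma sigsumU1 j i S : i \notin S ->
  sigsum c j (i |: S)%SET x = sigsum c j S x + x i * sigsum c j.+1 S x.
Proof.
move=> iS; rewrite /sigsum (bigID (fun A : {set 'I_n} => i \notin A)) /=.
congr (_ + _).
  apply: eq_bigl => A; apply/andP/idP => [[AS iA]|AS].
    by rewrite -(finset.setU1K iS) finset.subsetD1 AS.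
  split; first exact: fintype.subset_trans AS (finset.subsetUr _ _).
  by apply: contra iS; apply: fintype.subsetP.
rewrite big_distrr /=.
rewrite (reindex_onto (fun A => i |: A)%SET (fun A => A :\ i)%SET) /=; last first.
  by move=> A /andP[_]; rewrite negbK => iA; rewrite finset.setD1K.
apply: eq_big => [A|A /andP[_ /eqP AE]].
  rewrite !inE eqxx /= andbT; apply/andP/idP => [[AS /eqP AE]|AS].
    rewrite -AE -(finset.setU1K iS); apply: finset.setSD.
    exact: AS.
  split; first by apply: finset.setUS.
  by rewrite finset.setU1K //; apply: contra iS; apply: fintype.subsetP.
have iA : i \notin A by rewrite -AE !inE eqxx.
by rewrite cardsU1 iA big_setU1 //= addnA addn1 mulrCA.
Qed.

Lemma sigsumD1 j i S : i \in S ->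
  sigsum c j S x = sigsum c j (S :\ i)%SET x + x i * sigsum c j.+1 (S :\ i)%SET x.
Proof. by move=> iS; rewrite -{1}(finset.setD1K iS) sigsumU1 // !inE eqxx. Qed.

Variables (a0 a1 : K).
Hypothesis c_rec :
  forall k, (k.+2 <= n)%N -> c k = a1 * c k.+1 - a0 * c k.+2.

(** The recursion is applied term by term; the bound makes it available for the largest index met,
    [j + #|S|]. *)
Lemma sigsum_rec j S : ((j + #|S|).+1 < n)%N ->
  sigsum c j S x = a1 * sigsum c j.+1 S x - a0 * sigsum c j.+2 S x.
Proof.
move=> jS; rewrite /sigsum !big_distrr /= -sumrB; apply: eq_bigr => A AS.
rewrite c_rec; last first.
  by apply: leq_trans jS; rewrite !ltnS leq_add2l subset_leq_card.
by rewrite !addSn mulrBl !mulrA.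
Qed.

(** Write [a1 = l + m] and [a0 = l * m]. The form on the left factors as [(X - l Y) (X - m Y)], and
    by [sigsum_rec] adding the variable [x i] multiplies the two factors, taken at [j.+1], by
    [x i + m] and [x i + l]. The product of these is [x i ^+ 2 + a1 * x i + a0]. *)
Lemma sigsum_norm j S : (j + #|S| < n)%N ->
  sigsum c j S x ^+ 2 - a1 * sigsum c j S x * sigsum c j.+1 S x
    + a0 * sigsum c j.+1 S x ^+ 2
  = (c (j + #|S|)%N ^+ 2 - a1 * c (j + #|S|)%N * c (j + #|S|).+1
       + a0 * c (j + #|S|).+1 ^+ 2)
    * \prod_(i in S) (x i ^+ 2 + a1 * x i + a0).
Proof.
elim/set_addone_ind: S j => [|i S iS IH] j jS.
  by rewrite !sigsum0 big_set0 cards0 addn0 mulr1.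
move: jS; rewrite cardsU1 iS add1n addnS => jS.
have := IH j.+1; rewrite addSn => /(_ jS) {}IH.
rewrite big_setU1 //= [RHS]mulrCA -IH !sigsumU1 // (@sigsum_rec j S) //.
by ring.
Qed.

(* This quantity is [F xi_i'] along a solution: that it does not depend on [i]
   makes the differences [xi_i - xi_1] constant. *)
Definition xi_slope i : K :=
  (2 * x i + a1) * sigsum c 0 ([set: 'I_n] :\ i)%SET x
  - (a1 * x i + 2 * a0) * sigsum c 1 ([set: 'I_n] :\ i)%SET x.

Lemma card_setTD1 (i : 'I_n) : #|([set: 'I_n] :\ i)%SET| = n.-1.
Proof.
have := cardsD1 i [set: 'I_n]%SET.
by rewrite finset.in_setT cardsT card_ord add1n => /(congr1 predn).
Qed.

Lemma xi_slope_indep i k : xi_slope i = xi_slope k.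
Proof.
have [->//|ik] := eqVneq i k; rewrite /xi_slope.
pose S := (([set: 'I_n] :\ i) :\ k)%SET.
have ki : k \in ([set: 'I_n] :\ i)%SET by rewrite !inE eq_sym ik.
have ik' : i \in ([set: 'I_n] :\ k)%SET by rewrite !inE ik.
have SE : (([set: 'I_n] :\ k) :\ i)%SET = S.
  by apply/setP => l; rewrite !finset.inE !andbT andbC.
have cS : ((0 + #|S|).+1 < n)%N.
  have := cardsD1 i [set: 'I_n]%SET; rewrite finset.in_setT cardsT card_ord.
  have := cardsD1 k ([set: 'I_n] :\ i)%SET; rewrite ki => ->.
  by rewrite !add1n add0n => nE; apply: eq_leq; rewrite [RHS]nE.
(* With [s1] and [s2] the shifted sums over [S], both sides become [(2 x_i x_k + a1 (x_i + x_k) +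
   a1^2 - 2 a0) s1 - (a1 x_i x_k + 2 a0 (x_i + x_k) + a0 a1) s2]. *)
rewrite !(sigsumD1 _ ki) !(sigsumD1 _ ik') SE -/S (sigsum_rec cS).
by ring.
Qed.

Lemma xi_slope_sqr (i : 'I_n) :
  xi_slope i ^+ 2 - (a1 ^+ 2 - 4 * a0) * sigsum c 0 [set: 'I_n]%SET x ^+ 2
  = 4 * (c n.-1 ^+ 2 - a1 * c n.-1 * c n + a0 * c n ^+ 2)
    * \prod_k (x k ^+ 2 + a1 * x k + a0).
Proof.
have n_gt0 : (0 < n)%N by apply: leq_ltn_trans (ltn_ord i).
(* With [n.-1] variables and [j = 0] the size bound is just met, so that only [c n.-1] and [c n]
   remain. *)
have := @sigsum_norm 0 ([set: 'I_n] :\ i)%SET.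
rewrite add0n card_setTD1 prednK // => /(_ (leqnn _)) nE.
rewrite (bigD1 i) //= (sigsumD1 0 (finset.in_setT i)) /xi_slope.
rewrite (eq_bigl (mem ([set: 'I_n] :\ i)%SET)); last first.
  by move=> k; rewrite !inE andbT.
rewrite -[RHS]mulrA [X in _ = _ * X]mulrCA -nE; by ring.
Qed.

End SigsumAlgebra.

(** * Derivatives of sums and products *)

Section Derivatives.
Variables (R : realType) (V : normedModType R).
Implicit Types (a v : V).

(** The variables are functions on an arbitrary normed space, so that one formula covers partial
    derivatives in [p], time derivatives along a solution and directional derivatives on phase
    space. *)
Lemma is_derive_sigsum (n : nat) (c : nat -> R) (x : V -> 'I_n -> R)
    (dx : 'I_n -> R) a v (S : {set 'I_n}) (j : nat) :
  (forall i, is_derive a v (fun y => x y i) (dx i)) ->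
  is_derive a v (fun y => sigsum c j S (x y))
    (\sum_(i in S) dx i * sigsum c j.+1 (S :\ i)%SET (x a)).
Proof.
move=> xD; elim/set_addone_ind: S j => [|i S iS IH] j.
  rewrite big_set0 (_ : (fun _ => _) = cst (c j)); first exact: is_derive_cst.
  by apply/funext => y; rewrite sigsum0.
rewrite (_ : (fun y => _) = (fun y => sigsum c j S (x y)) +
    (fun y => x y i) * (fun y => sigsum c j.+1 S (x y))); last first.
  by apply/funext => y; rewrite sigsumU1.
have D := is_deriveD (IH j) (is_deriveM (xD i) (IH j.+1)).
apply: is_derive_eq D _; rewrite /GRing.scale /= big_setU1 //=.
rewrite (finset.setU1K iS) addrA addrC; congr (_ + _); first by rewrite mulrC.
rewrite mulr_sumr -big_split /=; apply: eq_bigr => k kS.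
have ik : i != k by apply: contraNneq iS => ->.
(* Removing [k] commutes with adding [i], so the two contributions of [k] recombine by
   [sigsumU1]. *)
rewrite (_ : ((i |: S) :\ k)%SET = (i |: (S :\ k))%SET); last first.
  apply/setP => l; rewrite !finset.inE.
  by case: (eqVneq l i) => [->|_] //=; rewrite ik.
rewrite sigsumU1; last by rewrite !finset.inE negb_and iS orbT.
by rewrite mulrDr mulrCA.
Qed.

Lemma differentiable_sigsum (n : nat) (c : nat -> R) (x : V -> 'I_n -> R) a
    (S : {set 'I_n}) (j : nat) :
  (forall i, differentiable (fun y => x y i) a) ->
  differentiable (fun y => sigsum c j S (x y)) a.
Proof.
move=> xD; elim/set_addone_ind: S j => [|i S iS IH] j.
  rewrite (_ : (fun _ => _) = cst (c j)); first exact: differentiable_cst.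
  by apply/funext => y; rewrite sigsum0.
rewrite (_ : (fun y => _) = (fun y => sigsum c j S (x y)) +
    (fun y => x y i) * (fun y => sigsum c j.+1 S (x y))).
  by apply: differentiableD => //; apply: differentiableM.
by apply/funext => y; rewrite sigsumU1.
Qed.

Lemma differentiable_prod (I : Type) (s : seq I) (x : I -> V -> R) a :
  (forall i, differentiable (x i) a) ->
  differentiable (fun y => \prod_(i <- s) x i y) a.
Proof.
move=> xD; elim: s => [|i s IH].
  rewrite (_ : (fun _ => _) = cst 1); first exact: differentiable_cst.
  by apply/funext => y; rewrite big_nil.
rewrite (_ : (fun y => _) = x i * (fun y => \prod_(i <- s) x i y)).
  exact: differentiableM.
by apply/funext => y; rewrite big_cons.
Qed.

(** The logarithmic form suits the equations of motion, which determine the quotients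
    [p_i'' / p_i']. *)
Lemma is_derive_prod (I : Type) (s : seq I) (x : I -> V -> R) (dx : I -> R) a v :
  (forall i, is_derive a v (x i) (dx i)) -> (forall i, x i a != 0) ->
  is_derive a v (fun y => \prod_(i <- s) x i y)
    (\prod_(i <- s) x i a * \sum_(i <- s) dx i / x i a).
Proof.
move=> xD x0; elim: s => [|i s IH].
  rewrite !big_nil mulr0 (_ : (fun _ => _) = cst 1); first exact: is_derive_cst.
  by apply/funext => y; rewrite big_nil.
rewrite (_ : (fun y => _) = x i * (fun y => \prod_(i <- s) x i y)); last first.
  by apply/funext => y; rewrite big_cons.
apply: is_derive_eq (is_deriveM (xD i) IH) _; rewrite /GRing.scale /= !big_cons.
set P := \prod_(_ <- _) _; set S := \sum_(_ <- _) _.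
by field.
Qed.

Lemma is_derive_inv (f : V -> R) a v df : f a != 0 -> is_derive a v f df ->
  is_derive a v (fun y => (f y)^-1) (- df / f a ^+ 2).
Proof.
move=> fa0 [fD <-]; apply: DeriveDef; first exact: derivableV.
by rewrite deriveV // /GRing.scale /= !mulNr mulrC.
Qed.

Lemma is_derive_div (f g : V -> R) a v df dg : g a != 0 ->
  is_derive a v f df -> is_derive a v g dg ->
  is_derive a v (fun y => f y / g y) ((df * g a - f a * dg) / g a ^+ 2).
Proof.
move=> ga0 fD gD; apply: is_derive_eq (is_deriveM fD (is_derive_inv ga0 gD)) _.
by rewrite /GRing.scale /=; field.
Qed.

End Derivatives.

(** * Real functions of one variable *)

Section RealFunctions.
Variable R : realType.
Implicit Types (a b c d s t x y : R) (f g h : R -> R).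

Lemma is_derive_within_continuous a b a' b' f (df : R -> R) :
  (forall t, a < t < b -> is_derive t 1 f (df t)) ->
  a < a' -> b' < b -> {within `[a', b'], continuous f}.
Proof.
move=> fD aa' bb'; apply: derivable_within_continuous => t.
rewrite in_itv /= => /andP[a't tb'].
have [] // := fD t; by rewrite (lt_le_trans aa' a't) (le_lt_trans tb' bb').
Qed.

(** By the mean value theorem, two equal values would force a zero of the derivative between
    them. *)
Lemma derive_neq0_inj a b f (df : R -> R) :
  (forall t, a < t < b -> is_derive t 1 f (df t)) ->
  (forall t, a < t < b -> df t != 0) ->
  forall x y, a < x < b -> a < y < b -> f x = f y -> x = y.
Proof.
move=> fD df0 x y xab yab fxy; apply/eqP/negPn/negP => xy.
wlog {xy} xy : x y xab yab fxy / x < y.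
  by move=> W; move: xy; rewrite neq_lt => /orP[|] /W; exact.
case/andP: xab => ax xb; case/andP: yab => ay yb.
have sub z : z \in `]x, y[ -> a < z < b.
  by rewrite in_itv /= => /andP[xz zy]; rewrite (lt_trans ax xz) (lt_trans zy yb).
have [z zxy|z zxy] := @MVT R f df x y xy _ (is_derive_within_continuous fD ax yb).
  exact/fD/sub.
rewrite fxy subrr => /esym/eqP; rewrite mulf_eq0 (negbTE (df0 _ (sub _ zxy))) /=.
by rewrite subr_eq0 gt_eqF.
Qed.

Lemma derive0_constant (D : set R) f :
  is_interval D -> (forall t, D t -> is_derive t 1 f 0) ->
  forall x y, D x -> D y -> f x = f y.
Proof.
move=> Ditv fD x y Dx Dy; wlog xy : x y Dx Dy / x <= y.
  by move=> W; have [/W|/ltW /W] := leP x y; [exact|move=> ->].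
have sub z : z \in `[x, y] -> D z by rewrite in_itv /= => /(Ditv x y Dx Dy).
have [||z _] := @MVT_segment R f (fun=> 0) x y xy.
- by move=> z zxy; apply/fD/sub; apply: subset_itv_oo_cc.
- by apply: derivable_within_continuous => z /sub /fD[].
- by move/eqP; rewrite mul0r subr_eq0 => /eqP.
Qed.

(** Used to shrink the time interval: an open condition at [s] becomes a condition on a closed
    interval strictly inside the given one. *)
Lemma near_subinterval (P : R -> Prop) a b s :
  a < s < b -> (\forall t \near s, P t) ->
  exists a' b', [/\ a < a', a' < s < b', b' < b &
    (forall t, a' <= t <= b' -> P t)].
Proof.
move=> sab Ps.
have : \forall t \near s, (t \in `]a, b[) /\ P t.
  by apply: filterI => //; apply: near_in_itvoo; rewrite in_itv.
move=> /nbhs_ballP[e /= e0 eP].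
have H t : s - e / 2 <= t <= s + e / 2 -> (t \in `]a, b[) /\ P t.
  move=> /andP[t1 t2]; apply: eP; rewrite /ball /= ltr_distlC; apply/andP; split; lra.
exists (s - e / 2), (s + e / 2); split.
- by have [|] := H (s - e / 2); [lra|rewrite in_itv /= => /andP[]].
- lra.
- by have [|] := H (s + e / 2); [lra|rewrite in_itv /= => /andP[]].
- by move=> t /H[].
Qed.

(** The primitive is the Lebesgue integral from [a']; the margins make [f] continuous, hence
    integrable, on the compact interval between [a'] and [b']. *)
Lemma primitive_exists a b a' b' f :
  a < a' -> b' < b ->
  (forall t, a < t < b -> {for t, continuous f}) ->
  exists h, forall t, a' < t < b' -> is_derive t 1 h (f t).
Proof.
move=> aa' bb' fc.
have fi : (@lebesgue_measure R).-integrable `[a', b'] (EFin \o f).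
  apply: continuous_compact_integrable; first exact: segment_compact.
  apply: continuous_in_subspaceT => t; rewrite inE /= in_itv /= => /andP[a't tb'].
  by apply: fc; rewrite (lt_le_trans aa' a't) (le_lt_trans tb' bb').
exists (fun x => \int[lebesgue_measure]_(t in [set` `[a', x]]) f t)%R => t /andP[a't tb'].
have ftc : {for t, continuous f} by apply: fc; rewrite (lt_trans aa') ?(lt_trans tb').
have [hD hE] := continuous_FTC1_closed tb' fi a't ftc.
by apply: DeriveDef => //; rewrite -derive1E hE.
Qed.

(** A continuous injection on a segment is strictly monotone, so its image is found from the values
    at the two ends; the order of these values is not known, hence the minimum and maximum below. *)
Lemma inverse_exists a b a' b' f (df : R -> R) :
  a < a' -> a' < b' -> b' < b ->
  (forall t, a < t < b -> is_derive t 1 f (df t)) ->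
  (forall t, a < t < b -> df t != 0) ->
  exists c d g,
    (forall t, a' < t < b' -> c < f t < d /\ g (f t) = t) /\
    (forall y, c < y < d ->
       [/\ a' < g y < b', f (g y) = y & is_derive y 1 g (df (g y))^-1]).
Proof.
move=> aa' ab' bb' fD df0.
have sub t : a' <= t <= b' -> a < t < b.
  by move=> /andP[a't tb']; rewrite (lt_le_trans aa') ?(le_lt_trans tb').
have subo t : a' < t < b' -> a < t < b.
  by move=> /andP[a't tb']; rewrite (lt_trans aa') ?(lt_trans tb').
have finj := derive_neq0_inj fD df0.
have fcont := is_derive_within_continuous fD aa' bb'.
pose c := Num.min (f a') (f b'); pose d := Num.max (f a') (f b').
(* The default value [a'] is irrelevant: only arguments in []c, d[], which are all attained,
   matter. *)
pose g y := xget a' [set t | a' < t < b' /\ f t = y].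
have fcd t : a' < t < b' -> c < f t < d.
  move=> /andP[a't tb'].
  have [ta tb] : t \in `[a', b'] /\ a' \in `[a', b'] by rewrite !in_itv /= !lexx !ltW.
  have tc : b' \in `[a', b'] by rewrite in_itv /= lexx ltW.
  rewrite /c /d gt_min lt_max.
  have [//|H|H] := @itv_continuous_inj_mono R f `[a', b'] fcont.
  - by move=> x y; rewrite !in_itv /= => /sub xab /sub yab; exact: finj.
  - by rewrite (H a' t) // (H t b') // orbT.
  - by rewrite (H b' t) // (H t a') // orbT.
have gK t : a' < t < b' -> g (f t) = t.
  move=> tab; rewrite /g; case: xgetP => [u _ [uab fu]|/(_ t)[]//].
  by apply: finj fu; exact: subo.
have fK y : c < y < d -> a' < g y < b' /\ f (g y) = y.
  move=> /andP[cy yd].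
  have [|t tab ty] := @IVT R f a' b' y (ltW ab') fcont.
    by rewrite !ltW.
  (* The intermediate value theorem only locates [t] in the closed segment; an end point would make
     [y] equal to [c] or [d]. *)
  have tab' : a' < t < b'.
    move: tab cy yd; rewrite in_itv /= -ty /c /d gt_min lt_max => /andP[].
    rewrite !le_eqVlt => /predU1P[<- _|a't /predU1P[->|tb' _ _]]; last by rewrite a't.
      by rewrite !ltxx /= => H /(lt_trans H); rewrite ltxx.
    by rewrite !ltxx /= !orbF => H /(lt_trans H); rewrite ltxx.
  by rewrite -ty gK.
exists c, d, g; split=> [t tab|y ycd]; first by split; [exact: fcd|exact: gK].
have [gab fgy] := fK _ ycd; split=> //.
have gnear : \forall t \near g y, t \in `]a', b'[ by apply: near_in_itvoo; rewrite in_itv.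
rewrite -[X in is_derive X]fgy; apply: (@is_derive_inverse R f).
- by near=> t; apply: gK; near: t; apply: filterS gnear => t; rewrite in_itv.
- near=> t; apply/differentiable_continuous/derivable1_diffP.
  have /subo /fD[] // : a' < t < b'.
  by near: t; apply: filterS gnear => u; rewrite in_itv.
- by apply: fD; exact: subo.
- by apply: df0; exact: subo.
Unshelve. all: by end_near. Qed.

End RealFunctions.

(** * Quadratures *)

Section Quadratures.
Variable R : realType.
Implicit Types (a b c d s t x y : R) (f g h : R -> R).

Lemma by_quadratures_sub a b a' b' f :
  by_quadratures a b f -> a <= a' -> b' <= b -> by_quadratures a' b' f.
Proof.
move=> fq; elim: fq a' b' => {a b f}.
- by move=> *; exact: bq_cst.
- by move=> *; exact: bq_id.
- by move=> a b f g _ fq _ gq a' b' aa' bb'; apply: bq_add; [exact: fq|exact: gq].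
- by move=> a b f g _ fq _ gq a' b' aa' bb'; apply: bq_mul; [exact: fq|exact: gq].
- move=> a b f _ fq f0 a' b' aa' bb'; apply: bq_inv; first exact: fq.
  by move=> x /andP[ax xb]; apply: f0; rewrite (le_lt_trans aa') ?(lt_le_trans xb).
- move=> a b f g _ gq fD a' b' aa' bb'; apply: bq_primitive; first exact: gq aa' bb'.
  by move=> x /andP[ax xb]; apply: fD; rewrite (le_lt_trans aa') ?(lt_le_trans xb).
- move=> a b c d f g h gq _ ginj _ hq fgh a' b' aa' bb'.
  apply: bq_inverse gq ginj (hq _ _ aa' bb') _ => x /andP[ax xb].
  by apply: fgh; rewrite (le_lt_trans aa') ?(lt_le_trans xb).
Qed.

Lemma by_quadratures_sum a b (I : Type) (s : seq I) (P : pred I) (f : I -> R -> R) :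
  (forall i, by_quadratures a b (f i)) ->
  by_quadratures a b (fun x => \sum_(i <- s | P i) f i x).
Proof.
move=> fq; elim: s => [|i s IH].
  rewrite (_ : (fun _ => _) = fun=> 0); first exact: bq_cst.
  by apply/funext => x; rewrite big_nil.
rewrite (_ : (fun _ => _) =
  fun x => (if P i then 1 else 0) * f i x + \sum_(i <- s | P i) f i x).
  by apply: bq_add => //; apply: bq_mul => //; exact: bq_cst.
by apply/funext => x; rewrite big_cons; case: ifP; rewrite ?mul1r // mul0r add0r.
Qed.

Lemma by_quadratures_prod a b (I : Type) (s : seq I) (P : pred I) (f : I -> R -> R) :
  (forall i, by_quadratures a b (f i)) ->
  by_quadratures a b (fun x => \prod_(i <- s | P i) f i x).
Proof.
move=> fq; elim: s => [|i s IH].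
  rewrite (_ : (fun _ => _) = fun=> 1); first exact: bq_cst.
  by apply/funext => x; rewrite big_nil.
rewrite (_ : (fun _ => _) = fun x => (if P i then f i x else 1) *
    \prod_(i <- s | P i) f i x).
  by apply: bq_mul => //; case: (P i) => //; exact: bq_cst.
by apply/funext => x; rewrite big_cons; case: ifP; rewrite ?mul1r.
Qed.

(** The root inverts squaring on []0, M[]; the bound [M] is there because [bq_inverse] works on a
    bounded interval. *)
Lemma by_quadratures_sqrt a b f (M : R) : by_quadratures a b f ->
  (forall x, a < x < b -> 0 < f x < M ^+ 2) -> 0 < M ->
  by_quadratures a b (fun x => Num.sqrt (f x)).
Proof.
move=> fq fpos M0.
apply: (@bq_inverse _ a b 0 M _ (fun y => y * y) f) => //.
- by apply: bq_mul; exact: bq_id.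
- move=> x y /andP[x0 _] /andP[y0 _]; rewrite -!expr2 => /eqP.
  by rewrite eqrXn2 // ?ltW // => /eqP.
- move=> x /fpos /andP[f0 fM]; rewrite -expr2 sqr_sqrtr ?ltW //; split=> //.
  by rewrite sqrtr_gt0 f0 -(gtr0_norm M0) -sqrtr_sqr ltr_sqrt // exprn_gt0.
Qed.

(* Writing [x' = phi x * psi] as [dx / phi x = psi dt], both sides are
   quadratures; the primitive of [1 / phi] is obtained as the primitive of
   [psi] composed with the inverse of [x]. *)
Lemma by_quadratures_separable a b a' b' (x phi psi : R -> R) :
  a < a' -> a' < b' -> b' < b ->
  (forall t, a < t < b -> {for t, continuous psi}) ->
  by_quadratures a' b' psi ->
  (forall t, a < t < b -> is_derive t 1 x (phi (x t) * psi t)) ->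
  (forall t, a < t < b -> phi (x t) * psi t != 0) ->
  (forall c d, (forall y, c < y < d -> exists2 t, a < t < b & x t = y) ->
     by_quadratures c d phi) ->
  by_quadratures a' b' x.
Proof.
move=> aa' ab' bb' psic psiq xD x0 phiq.
have subo t : a' < t < b' -> a < t < b.
  by move=> /andP[a't tb']; rewrite (lt_trans aa') ?(lt_trans tb').
have [h hD] := primitive_exists aa' bb' psic.
have [c [d [g [gK fK]]]] := inverse_exists aa' ab' bb' xD x0.
have phiqcd : by_quadratures c d phi.
  by apply: phiq => y /fK[gab fgy _]; exists (g y) => //; exact: subo.
have phi0 y : c < y < d -> phi y != 0.
  move=> /fK[/subo /x0 + fgy _]; rewrite fgy mulf_eq0 negb_or.
  by case/andP.
(* In the chain rule the factor [psi (g y)] cancels. *)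
have hgD y : c < y < d -> is_derive y 1 (h \o g) (phi y)^-1.
  move=> ycd; have [gab fgy gD] := fK _ ycd.
  apply: is_derive_eq (is_derive1_comp (hD _ gab) gD) _.
  have := x0 _ (subo _ gab); rewrite fgy mulf_eq0 negb_or => /andP[? ?].
  by field; apply/andP.
have phiV y : c < y < d -> (phi y)^-1 != 0 by move=> /phi0; rewrite invr_eq0.
apply: (@bq_inverse _ a' b' c d x (h \o g) h).
- apply: bq_primitive (bq_inv phiqcd phi0) hgD.
- exact: derive_neq0_inj hgD phiV.
- exact: bq_primitive psiq hD.
- by move=> t tab; have [? gt] := gK _ tab; rewrite /= gt.
Qed.

End Quadratures.

(** * Solutions of the system *)

Lemma is_derive_linear (R : realType) (V W : normedModType R)
    (f : {linear V -> W}) (x v : V) :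
  continuous f -> is_derive x v f (f v).
Proof.
move=> fc; have fD := @linear_differentiable _ _ _ f x fc.
by apply: DeriveDef; [exact: diff_derivable|rewrite deriveE // diff_lin].
Qed.

Lemma is_derive_coord (R : realType) (n : nat) (x v : 'rV[R]_n) (i : 'I_n) :
  is_derive x v (fun y : 'rV[R]_n => y 0 i) (v 0 i).
Proof.
have coord_lin : linear (fun y : 'rV[R]_n => y 0 i : R).
  by move=> k y z; rewrite !mxE.
pose f : {linear 'rV[R]_n -> R} :=
  HB.pack (fun y : 'rV[R]_n => y 0 i : R) (GRing.isLinear.Build _ _ _ _ _ coord_lin).
exact: (is_derive_linear x v (f := f) (@coord_continuous _ _ _ 0 i)).
Qed.

Section HessianPolynomials.
Variables (R : realType) (n : nat).

Lemma sum_sigma (c : nat -> R) (x : 'rV[R]_n) :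
  \sum_(k < n.+1) c k * sigma k x = sigsum c 0 [set: 'I_n]%SET (x 0).
Proof.
rewrite /sigsum /sigma.
(* Subsets are grouped by cardinality, which is at most [n], so [inord] does not alter it. *)
rewrite (partition_big (fun A : {set 'I_n} => inord #|A| : 'I_n.+1) xpredT) //=.
apply: eq_bigr => k _; rewrite mulr_sumr; apply: eq_big => [A|A /eqP <-] //.
have An : (#|A| < n.+1)%N by rewrite ltnS -[X in (_ <= X)%N]card_ord max_card.
by rewrite finset.subsetT /= -val_eqE /= inordK.
Qed.

Variable E : hessian_equation R n.

Definition coef (k : nat) : R := hess_coef E k%:Z.

Lemma hess_FE x : hess_F E x = sigsum coef 0 [set: 'I_n]%SET (x 0).
Proof. exact: sum_sigma. Qed.

Lemma hess_GE x : hess_G E x =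
  sigsum (fun k => hess_coef E (k%:Z - 1)) 0 [set: 'I_n]%SET (x 0).
Proof. exact: (@sum_sigma (fun k => hess_coef E (k%:Z - 1))). Qed.

Lemma derive_hess_F x i : 'D_(delta_mx 0 i : 'rV[R]_n) (hess_F E) x =
  sigsum coef 1 ([set: 'I_n] :\ i)%SET (x 0).
Proof.
rewrite (_ : hess_F E = fun y => sigsum coef 0 [set: 'I_n]%SET (y 0)); last first.
  by apply/funext => y; exact: hess_FE.
have := @is_derive_sigsum R _ n coef (fun (y : 'rV[R]_n) i => y 0 i)
  _ x (delta_mx 0 i) [set: 'I_n]%SET 0 (is_derive_coord x (delta_mx 0 i)).
move=> /@derive_val ->; rewrite (bigD1 i) ?finset.in_setT //= mxE !eqxx mul1r.
by rewrite big1 ?addr0 // => k /andP[_ /negbTE ki]; rewrite mxE ki andbF mul0r.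
Qed.

End HessianPolynomials.

Lemma C2_on_is_derive (R : realType) (D : set R) (f : R -> R) (t : R) :
  C2_on D f -> D t ->
  [/\ is_derive t 1 f (derive1 f t),
      is_derive t 1 (derive1 f) (derive1n 2 f t),
      {for t, continuous f} & {for t, continuous (derive1 f)}].
Proof.
move=> fC Dt; have [fc /(_ 1 1)[fD ffD f'c _]] := fC t Dt.
have fE : derive1 f = 'D_1 f by apply/funext => u; rewrite derive1E.
split; last by rewrite fE.
- by rewrite fE; exact: (derivableP fD).
- by rewrite derive1nS derive1n1 derive1E fE; exact: (derivableP ffD).
- exact: fc.
Qed.

Section Solution.
Variables (R : realType) (n : nat) (E : hessian_equation R n) (a0 a1 : R).
Variables (D : set R) (p : 'I_n -> R -> R) (r : R -> R).
Hypothesis sol : regular_solution E D p r.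

Let x t i := p i t.
Let c := coef E.

Let D_itv : is_interval D. Proof. by case: sol => -[]. Qed.

Lemma solution_derive t i : D t ->
  is_derive t 1 (p i) (derive1 (p i) t).
Proof.
by case: sol => -[_ _ [pC _] _ _ Dt]; have [] := C2_on_is_derive (pC i) Dt.
Qed.

Lemma solution_F_neq0 t : D t -> sigsum c 0 [set: 'I_n]%SET (x t) != 0.
Proof.
case: sol => _ reg /reg[_]; rewrite hess_FE; congr (sigsum _ _ _ _ != 0).
by apply/funext => i; rewrite mxE.
Qed.

Lemma solution_velocity_neq0 t i : D t -> derive1 (p i) t != 0.
Proof. by case: sol => _ reg /reg[/(_ i)]; rewrite mxE. Qed.

(** This is the equation of motion solved for [p_i''], with the partial derivative of [F] written as
    a shifted sum. *)
Lemma solution_acceleration t i : D t ->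
  is_derive t 1 (derive1 (p i))
    (2 * derive1 (p i) t ^+ 2 * sigsum c 1 ([set: 'I_n] :\ i)%SET (x t)
       / sigsum c 0 [set: 'I_n]%SET (x t)).
Proof.
move=> Dt; have F0 := solution_F_neq0 Dt.
case: sol => -[_ _ [pC _] ode _]; have [_ pD _ _] := C2_on_is_derive (pC i) Dt.
apply: is_derive_eq pD _; have [/(_ i) + _] := ode t Dt.
rewrite hess_FE derive_hess_F.
have -> : (\row_i p i t : 'rV[R]_n) 0 = x t by apply/funext => k; rewrite mxE.
rewrite -/c => eqn; apply: (mulIf F0); rewrite divfK // -mulrA -eqn.
by field.
Qed.

Lemma F2_over_prod_state t : F2_over_prod E (state p t) =
  sigsum c 0 [set: 'I_n]%SET (x t) ^+ 2 / \prod_i derive1 (p i) t.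
Proof.
rewrite /F2_over_prod hess_FE; congr (sigsum _ _ _ _ ^+ 2 / _).
  by apply/funext => i; rewrite mxE.
by apply: eq_bigr => i _; rewrite mxE.
Qed.

Lemma xi_state t i : xi a0 a1 i (state p t) =
  (p i t ^+ 2 + a1 * p i t + a0) / derive1 (p i) t.
Proof. by rewrite /xi !mxE. Qed.

Lemma F2_over_prod_derive t : D t ->
  is_derive t 1 (fun u => F2_over_prod E (state p u)) 0.
Proof.
move=> Dt; have F0 := solution_F_neq0 Dt.
rewrite (_ : (fun _ => _) = fun t => (sigsum c 0 [set: 'I_n]%SET (x t) *
    sigsum c 0 [set: 'I_n]%SET (x t)) / \prod_i derive1 (p i) t); last first.
  by apply/funext => u; rewrite F2_over_prod_state expr2.
have FD := @is_derive_sigsum R _ n c x _ t 1 [set: 'I_n]%SET 0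
  (fun i => solution_derive i Dt).
have PD := is_derive_prod (index_enum 'I_n) (fun i => solution_acceleration i Dt)
  (fun i => solution_velocity_neq0 i Dt).
have P0 : \prod_i derive1 (p i) t != 0.
  by apply/prodf_neq0 => i _; exact: solution_velocity_neq0.
apply: is_derive_eq (is_derive_div P0 (is_deriveM FD FD) PD) _.
rewrite /GRing.scale /=; set F := sigsum c 0 _ _ in F0 *.
set P := \prod_(i <- _) _; set S := \sum_(i in _) _; set T := \sum_(i <- _) _.
(* By the equations of motion the logarithmic derivative of the product of velocities equals that of
   [F^2]. *)
have -> : T = 2 * S / F.
  rewrite /S mulr_sumr mulr_suml; apply: eq_big => [i|i _].
    by rewrite finset.in_setT.
  by have := solution_velocity_neq0 i Dt => v0; field; rewrite F0 v0.
rewrite -[X in X * (P * _)]/(F * F).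
by field; rewrite F0 P0.
Qed.

Lemma F2_over_prod_constant s t : D s -> D t ->
  F2_over_prod E (state p s) = F2_over_prod E (state p t).
Proof.
by apply: (derive0_constant D_itv (f := fun u => F2_over_prod E (state p u)));
  exact: F2_over_prod_derive.
Qed.

(** In the quotient rule the term with [p_i''] is [- 2 (p_i^2 + a1 p_i + a0) B / F]; putting the
    rest over [F = A + p_i B] cancels the terms [2 p_i^2 B]. *)
Lemma xi_derive t i : D t ->
  is_derive t 1 (fun u => xi a0 a1 i (state p u))
    (xi_slope c (x t) a0 a1 i / sigsum c 0 [set: 'I_n]%SET (x t)).
Proof.
move=> Dt; have F0 := solution_F_neq0 Dt; have v0 := solution_velocity_neq0 i Dt.
rewrite (_ : (fun _ => _) =
    (fun t => (p i t * p i t + (cst a1 t * p i t + cst a0 t)) / derive1 (p i) t)).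
  have pD := solution_derive i Dt.
  have QD := is_deriveD (is_deriveM pD pD)
    (is_deriveD (is_deriveM (is_derive_cst a1 t 1) pD) (is_derive_cst a0 t 1)).
  apply: is_derive_eq (is_derive_div v0 QD (solution_acceleration i Dt)) _.
  move: F0; rewrite /GRing.scale /= !fctE /xi_slope.
  rewrite (sigsumD1 c (x t) 0 (finset.in_setT i)) /cst /x.
  set A := sigsum c 0 _ _; set B := sigsum c 1 _ _ => F0.
  by field; rewrite F0 v0.
by apply/funext => u; rewrite xi_state /cst /= addrA expr2.
Qed.

Hypothesis rec : recursive_type E a0 a1.

(** This is [recursive_type] at index [k.+1], moved from integers to natural numbers. *)
Lemma coef_rec k : (k.+2 <= n)%N -> c k = a1 * c k.+1 - a0 * c k.+2.
Proof.
move=> kn; have kn1 : (1 <= k.+1 <= n.-1)%N.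
  by rewrite /= -ltnS (ltn_predK kn).
rewrite /c /coef; have := rec kn1.
have -> : k.+1%:Z - 1 = k%:Z by rewrite -addn1 PoszD addrK.
by have -> : k.+1%:Z + 1 = k.+2%:Z by rewrite -PoszD addn1.
Qed.

Lemma xi_difference_constant i k s t : D s -> D t ->
  xi a0 a1 i (state p s) - xi a0 a1 k (state p s) =
  xi a0 a1 i (state p t) - xi a0 a1 k (state p t).
Proof.
apply: (derive0_constant D_itv
  (f := fun u => xi a0 a1 i (state p u) - xi a0 a1 k (state p u))) => u Du.
apply: is_derive_eq (is_deriveB (xi_derive i Du) (xi_derive k Du)) _.
by rewrite (xi_slope_indep (x u) coef_rec i k) subrr.
Qed.

(** [xi_slope_sqr] is divided by [F^2]: the product of the quadratics is the product of the [xi_j]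
    times that of the velocities, and the latter over [F^2] is the inverse of [F2_over_prod]. *)
Lemma xi_slope_equation t i : D t ->
  (xi_slope c (x t) a0 a1 i / sigsum c 0 [set: 'I_n]%SET (x t)) ^+ 2 =
  k1 a0 a1 + k2 a0 a1 (hess_coef E (n%:Z - 1)) (hess_coef E n%:Z)
               / F2_over_prod E (state p t)
             * \prod_j xi a0 a1 j (state p t).
Proof.
move=> Dt; have F0 := solution_F_neq0 Dt.
have P0 : \prod_i derive1 (p i) t != 0.
  by apply/prodf_neq0 => k _; exact: solution_velocity_neq0.
have n_gt0 : (0 < n)%N by apply: leq_ltn_trans (ltn_ord i).
have -> : hess_coef E (n%:Z - 1) = c n.-1.
  rewrite /c /coef; congr (hess_coef E _).
  by rewrite -{1}(prednK n_gt0) -addn1 PoszD addrK.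
have -> : \prod_j xi a0 a1 j (state p t) =
    (\prod_j (x t j ^+ 2 + a1 * x t j + a0)) / \prod_j derive1 (p j) t.
  by rewrite -prodf_div; apply: eq_bigr => j _; rewrite xi_state.
have := xi_slope_sqr (x t) coef_rec i; rewrite F2_over_prod_state -/c.
set F := sigsum _ _ _ _ in F0 *; set H := xi_slope _ _ _ _ _.
move=> /eqP; rewrite subr_eq => /eqP HE.
rewrite expr_div_n HE /k1 /k2 -[hess_coef E n%:Z]/(c n).
by field; rewrite F0 P0.
Qed.

End Solution.

(** * Integration of the solutions by quadratures *)

Lemma is_derive_continuous (R : realType) (f : R -> R) (t df : R) :
  is_derive t 1 f df -> {for t, continuous f}.
Proof. by case=> fD _; apply/differentiable_continuous/derivable1_diffP. Qed.

Lemma by_quadratures_sigsum (R : realType) (n : nat) (c : nat -> R) (a b : R)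
    (x : 'I_n -> R -> R) (S : {set 'I_n}) (j : nat) :
  (forall i, by_quadratures a b (x i)) ->
  by_quadratures a b (fun t => sigsum c j S (x ^~ t)).
Proof.
move=> xq; apply: by_quadratures_sum => A.
by apply: bq_mul; [exact: bq_cst|exact: by_quadratures_prod].
Qed.

Lemma quadratic_not_three_roots (R : realType) (a0 a1 x y z : R) :
  x != y -> y != z -> x != z ->
  x ^+ 2 + a1 * x + a0 = 0 -> y ^+ 2 + a1 * y + a0 = 0 ->
  z ^+ 2 + a1 * z + a0 = 0 -> False.
Proof.
move=> xy yz xz x0 y0 z0.
have sum u v : u != v -> u ^+ 2 + a1 * u + a0 = 0 -> v ^+ 2 + a1 * v + a0 = 0 ->
    u + v + a1 = 0.
  move=> uv u0 v0; have : (u - v) * (u + v + a1) = 0.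
    by rewrite -[RHS](subrr 0) -{1}u0 -v0; ring.
  by move/eqP; rewrite mulf_eq0 subr_eq0 (negbTE uv) => /eqP.
have s1 := sum x y xy x0 y0; have s2 := sum y z yz y0 z0.
have xzE : x = z by clear - s1 s2; lra.
by rewrite xzE eqxx in xz.
Qed.

Section SolutionQuadratures.
Variables (R : realType) (n : nat) (E : hessian_equation R n) (a0 a1 : R).
Variables (D : set R) (p : 'I_n -> R -> R) (r : R -> R).
Hypothesis sol : regular_solution E D p r.
Hypothesis rec : recursive_type E a0 a1.

Let xis i t := xi a0 a1 i (state p t).
Let F t := sigsum (coef E) 0 [set: 'I_n]%SET (p ^~ t).
Let v i t := xi_slope (coef E) (p ^~ t) a0 a1 i / F t.

Lemma xi_slope_continuous i t : D t -> {for t, continuous (v i)}.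
Proof.
move=> Dt; have F0 := solution_F_neq0 sol Dt.
have xD k := solution_derive sol k Dt.
have SD S j := is_derive_sigsum (coef E) S j xD.
have sD S j : {for t, continuous (fun u => sigsum (coef E) j S (p ^~ u))}.
  exact: is_derive_continuous (SD S j).
have pc := is_derive_continuous (xD i).
apply: continuousM; last by apply: continuousV => //; exact: sD.
apply: continuousB; apply: continuousM; try exact: sD.
  apply: continuousD; last exact: cst_continuous.
  by apply: continuousM => //; exact: cst_continuous.
apply: continuousD; last exact: cst_continuous.
by apply: continuousM => //; exact: cst_continuous.
Qed.

(** As [p_i'] does not vanish, [p_i] takes distinct values at three distinct times, and these cannot
    all be roots of the monic quadratic. *)
Lemma xi_neq0_somewhere i a b : a < b -> (forall t, a < t < b -> D t) ->
  exists2 t, a < t < b & xis i t != 0.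
Proof.
move=> ab abD; apply: contrapT => none.
have Q0 t : a < t < b -> p i t ^+ 2 + a1 * p i t + a0 = 0.
  move=> tab; apply/eqP/negPn/negP => Qt; apply: none; exists t => //.
  rewrite /xis xi_state mulf_neq0 // invr_neq0 //.
  exact: (solution_velocity_neq0 sol i (abD _ tab)).
have inj := derive_neq0_inj (fun t tab => solution_derive sol i (abD t tab))
  (fun t tab => solution_velocity_neq0 sol i (abD t tab)).
pose t1 := a + (b - a) / 4; pose t2 := a + (b - a) / 2.
pose t3 := a + (b - a) * 3 / 4.
have [t1ab t2ab t3ab] : [/\ a < t1 < b, a < t2 < b & a < t3 < b].
  by rewrite /t1 /t2 /t3; split; lra.
apply: (@quadratic_not_three_roots _ a0 a1 (p i t1) (p i t2) (p i t3)); try exact: Q0.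
- by apply/eqP => /inj; rewrite /t1 /t2 => /(_ t1ab t2ab); lra.
- by apply/eqP => /inj; rewrite /t2 /t3 => /(_ t2ab t3ab); lra.
- by apply/eqP => /inj; rewrite /t1 /t3 => /(_ t1ab t3ab); lra.
Qed.

(** Non-vanishing is an open condition, so the interval is shrunk once for each index in [l]. *)
Lemma xi_neq0_subinterval (l : seq 'I_n) a b :
  a < b -> (forall t, a < t < b -> D t) ->
  exists a' b', [/\ a <= a', a' < b', b' <= b &
    (forall i t, i \in l -> a' < t < b' -> xis i t != 0)].
Proof.
elim: l => [|i l IH] ab abD; first by exists a, b; split.
have [a' [b' [aa' ab' bb' xl]]] := IH ab abD.
have abD' t : a' < t < b' -> D t.
  by move=> /andP[a't tb']; apply: abD; rewrite (le_lt_trans aa') ?(lt_le_trans tb').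
have [t tab xit] := xi_neq0_somewhere i ab' abD'.
have : \forall u \near t, xis i u != 0.
  have xc : {for t, continuous (xis i)}.
    exact: is_derive_continuous (xi_derive a0 a1 sol i (abD' _ tab)).
  by apply: (xc [set y | y != 0]); apply: open_nbhs_nbhs; split=> //; exact: open_neq.
move=> /(near_subinterval tab)[a2 [b2 [aa2 /andP[a2t tb2] bb2 xi2]]].
exists a2, b2; split; try lra.
move=> k u; rewrite inE => /predU1P[->|kl] /andP[au ub].
  by apply: xi2; rewrite !ltW.
by apply: xl => //; rewrite (lt_trans aa2 au) (lt_trans ub bb2).
Qed.

(** Either the slope vanishes on the whole interval and [xi_i] is a primitive of zero, or it is
    nonzero at some [t], near which [xi_i] solves a separable equation. *)
Lemma xi_by_quadratures i a b : a < b -> (forall t, a < t < b -> D t) ->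
  exists a' b', [/\ a <= a', a' < b', b' <= b & by_quadratures a' b' (xis i)].
Proof.
move=> ab abD.
have [[t tab vt]|v0] := pselect (exists2 t, a < t < b & v i t != 0); last first.
  exists a, b; split=> //; apply: (@bq_primitive _ a b (xis i) (fun=> 0)).
    exact: bq_cst.
  move=> t tab; have := xi_derive a0 a1 sol i (abD t tab).
  rewrite -/(F t) -/(v i t) (_ : v i t = 0) //.
  by apply/eqP/negPn/negP => vt; apply: v0; exists t.
have Dt := abD t tab.
have vc : {for t, continuous (v i)} by exact: xi_slope_continuous.
(* The first condition fixes the sign of the slope, hence the branch of the root; the second
   provides the bound for [by_quadratures_sqrt]. *)
have : \forall u \near t, 0 < v i t * v i u /\ `|v i u| < `|v i t| + 1.
  apply: filterI.
    have : {for t, continuous (fun u => v i t * v i u)}.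
      by apply: continuousM => //; exact: cst_continuous.
    by move/cvgr_gt; apply; rewrite -expr2 exprn_even_gt0.
  have : {for t, continuous (fun u => `|v i u|)}.
    by apply: continuous_comp => //; exact: norm_continuous.
  by move/cvgr_lt; apply; rewrite ltrDl.
move=> /(near_subinterval tab)[a2 [b2 [aa2 /andP[a2t tb2] bb2 vP]]].
pose K := k2 a0 a1 (hess_coef E (n%:Z - 1)) (hess_coef E n%:Z)
            / F2_over_prod E (state p t).
pose kappa k := xis k t - xis i t.
(* Since [xi_k] is [xi_i + kappa k], the right-hand side becomes a polynomial in [xi_i] alone. *)
pose P y := k1 a0 a1 + K * \prod_k (y + kappa k).
have sub u : a2 < u < b2 -> a < u < b.
  by move=> /andP[au ub]; rewrite (lt_trans aa2 au) (lt_trans ub bb2).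
have PE u : a2 < u < b2 -> P (xis i u) = v i u ^+ 2.
  move=> uab; have Du := abD u (sub u uab).
  rewrite (xi_slope_equation sol rec i Du) /P /K.
  rewrite (F2_over_prod_constant sol Dt Du); congr (_ + _ * _).
  apply: eq_bigr => k _; rewrite /kappa /xis.
  by rewrite (xi_difference_constant sol rec k i Dt Du) addrC subrK.
have sgE u : a2 < u < b2 ->
    [/\ v i u != 0, `|v i u| < `|v i t| + 1 & Num.sg (v i t) * `|v i u| = v i u].
  move=> /andP[au ub]; have [|pos lt1] := vP u; first by rewrite !ltW.
  have vu0 : v i u != 0 by apply: contraTneq pos => ->; rewrite mulr0 ltxx.
  split=> //; have /eqP : Num.sg (v i t * v i u) = 1 by rewrite gtr0_sg.
  rewrite sgrM => /eqP sg1; rewrite [in RHS](numEsg (v i u)).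
  have : Num.sg (v i u) * Num.sg (v i u) = 1 by rewrite -sgrM gtr0_sg // -expr2 exprn_even_gt0.
  move=> su; congr (_ * _).
  by rewrite -[LHS]mulr1 -su mulrA sg1 mul1r.
have ph u : a2 < u < b2 ->
    Num.sg (v i t) * Num.sqrt (P (xis i u)) * cst 1 u = v i u.
  by move=> uab; rewrite PE // sqrtr_sqr /cst mulr1; case: (sgE _ uab).
(* The middle third leaves the strict margins that [by_quadratures_separable] asks for. *)
exists (a2 + (b2 - a2) / 3), (a2 + (b2 - a2) * 2 / 3).
have ab2 : a2 < b2 by apply: lt_trans tb2.
split; try lra.
apply: (@by_quadratures_separable _ a2 b2 _ _ _
  (fun y => Num.sg (v i t) * Num.sqrt (P y)) (cst 1)); try lra.
- by move=> u _; exact: cst_continuous.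
- exact: bq_cst.
- by move=> u uab; rewrite ph //; exact: (xi_derive a0 a1 sol i (abD u (sub u uab))).
- by move=> u uab; rewrite ph //; case: (sgE _ uab).
(* Only values taken by [xi_i] occur here; at these [P] is the square of the slope, hence positive
   and bounded. *)
- move=> c d cd; apply: bq_mul; first exact: bq_cst.
  apply: (@by_quadratures_sqrt _ _ _ _ (`|v i t| + 1)).
  + apply: bq_add; first exact: bq_cst.
    apply: bq_mul; first exact: bq_cst.
    by apply: by_quadratures_prod => k; apply: bq_add; [exact: bq_id|exact: bq_cst].
  + move=> y /cd[u uab <-]; have [vu0 ltM _] := sgE _ uab.
    rewrite PE // exprn_even_gt0 //= -real_normK ?num_real //.
    by rewrite vu0 ltrXn2r.
  + by rewrite ltr_wpDl.
Qed.

(** A single [xi_i] yields every [xi_k] up to a constant, after which the definition of [xi_k] is a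
    separable equation for [p_k]. *)
Lemma p_by_quadratures i k a b a' b' s :
  a < a' -> a' < b' -> b' < b -> D s -> (forall t, a < t < b -> D t) ->
  (forall t, a < t < b -> xis k t != 0) ->
  by_quadratures a b (xis i) -> by_quadratures a' b' (p k).
Proof.
move=> aa' ab' bb' Ds abD xik0 xiq.
pose kappa := xis k s - xis i s.
have xikE t : a < t < b -> xis i t + kappa = xis k t.
  move=> tab; rewrite /kappa /xis (xi_difference_constant sol rec k i Ds (abD _ tab)).
  by rewrite addrC subrK.
have pE t : a < t < b ->
    (p k t ^+ 2 + a1 * p k t + a0) * (xis i t + kappa)^-1 = derive1 (p k) t.
  move=> tab; have := xik0 _ tab; rewrite xikE // /xis xi_state.
  rewrite mulf_eq0 negb_or => /andP[Q0 _].
  have v0 := solution_velocity_neq0 sol k (abD _ tab).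
  by field; rewrite Q0 v0.
pose phi y := y ^+ 2 + a1 * y + a0; pose psi t := (xis i t + kappa)^-1.
have psic t : a < t < b -> {for t, continuous psi}.
  move=> tab; apply: continuousV; first by rewrite xikE // xik0.
  apply: continuousD; last exact: cst_continuous.
  exact: is_derive_continuous (xi_derive a0 a1 sol i (abD _ tab)).
have psiq : by_quadratures a' b' psi.
  apply: bq_inv.
    apply: bq_add; last exact: bq_cst.
    by apply: (by_quadratures_sub xiq); exact: ltW.
  move=> t /andP[a't tb']; have tab : a < t < b by rewrite (lt_trans aa') ?(lt_trans tb').
  by rewrite xikE // xik0.
have pD t : a < t < b -> is_derive t 1 (p k) (phi (p k t) * psi t).
  by move=> tab; rewrite /phi /psi pE //; exact: (solution_derive sol k (abD _ tab)).
have p'0 t : a < t < b -> phi (p k t) * psi t != 0.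
  move=> tab; rewrite /phi /psi pE //.
  exact: (solution_velocity_neq0 sol k (abD _ tab)).
have phiq c d : by_quadratures c d phi.
  rewrite (_ : phi = fun y => y * y + a1 * y + a0).
    apply: bq_add; last exact: bq_cst.
    by apply: bq_add; apply: bq_mul; try exact: bq_id; exact: bq_cst.
  by apply/funext => y; rewrite /phi expr2.
exact: (by_quadratures_separable aa' ab' bb' psic psiq pD p'0 (fun c d _ => phiq c d)).
Qed.

Lemma r_by_quadratures a b : (forall t, a < t < b -> D t) ->
  (forall k, by_quadratures a b (p k)) -> by_quadratures a b r.
Proof.
move=> abD pq; have [[_ _ [_ rC] ode] _] := sol.
apply: (@bq_primitive _ a b r (derive1 r)); last first.
  by move=> t /abD Dt; have [rD _ _ _] := C2_on_is_derive rC Dt; exact: rD.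
pose G t := sigsum (fun k => hess_coef E (k%:Z - 1)) 0 [set: 'I_n]%SET (p ^~ t).
apply: (@bq_primitive _ a b _ (fun t => -1 * G t * (F t)^-1)).
  apply: bq_mul.
    by apply: bq_mul; [exact: bq_cst|exact: by_quadratures_sigsum].
  apply: bq_inv; first exact: by_quadratures_sigsum.
  by move=> t /abD Dt; exact: (solution_F_neq0 sol Dt).
move=> t /abD Dt; have [_ rD _ _] := C2_on_is_derive rC Dt.
apply: is_derive_eq rD _.
have [_] := ode t Dt; rewrite hess_FE hess_GE.
have -> : (\row_i p i t : 'rV[R]_n) 0 = p ^~ t by apply/funext => k; rewrite mxE.
rewrite -/(F t) -/(G t) => rE; apply: (mulIf (solution_F_neq0 sol Dt)).
by rewrite -/(F t) rE divfK ?mulN1r //; exact: (solution_F_neq0 sol Dt).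
Qed.

(** The interval is shrunk until it lies in [D] and close to [s], no [xi_k] vanishes on it, and
    [xi_i] is a quadrature. The time [s] itself may be lost on the way; only closeness to it is
    kept. *)
Lemma solution_by_quadratures (i : 'I_n) s e : D s -> 0 < e ->
  exists a b : R,
    [/\ a < b, (forall x, a < x < b -> D x /\ `|x - s| < e),
        forall k, by_quadratures a b (p k) & by_quadratures a b r].
Proof.
move=> Ds e0; have [[Do _ _ _] _] := sol.
have sab : s - e < s < s + e by lra.
have [a [b [ea /andP[as_ sb] be abD]]] :=
  near_subinterval sab (open_nbhs_nbhs (conj Do Ds)).
have abD1 t : a < t < b -> D t by move=> /andP[? ?]; apply: abD; rewrite !ltW.
have [a2 [b2 [aa2 ab2 bb2 xi0]]] :=
  xi_neq0_subinterval (enum 'I_n) (lt_trans as_ sb) abD1.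
have abD2 t : a2 < t < b2 -> D t.
  by move=> /andP[? ?]; apply: abD1; apply/andP; split; lra.
have [a3 [b3 [aa3 ab3 bb3 xiq]]] := xi_by_quadratures i ab2 abD2.
have sub3 t : a3 < t < b3 -> a2 < t < b2.
  by move=> /andP[? ?]; apply/andP; split; lra.
pose a4 := a3 + (b3 - a3) / 3; pose b4 := a3 + (b3 - a3) * 2 / 3.
have [a34 ab4 b34] : [/\ a3 < a4, a4 < b4 & b4 < b3].
  by rewrite /a4 /b4; split; lra.
have sub4 t : a4 < t < b4 -> a3 < t < b3.
  by move=> /andP[? ?]; apply/andP; split; lra.
have pq k : by_quadratures a4 b4 (p k).
  apply: (p_by_quadratures a34 ab4 b34 Ds _ _ xiq) => t /sub3 tab.
    exact: abD2.
  by apply: xi0 => //; rewrite mem_enum.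
exists a4, b4; split=> // [t tab|].
  split; first exact/abD2/sub3/sub4.
  have /andP[? ?] := sub4 _ tab.
  by rewrite ltr_norml; apply/andP; split; lra.
by apply: r_by_quadratures => // t /sub4/sub3 /abD2.
Qed.

End SolutionQuadratures.

(** * Functional independence *)

Section PhaseSpace.
Variables (R : realType) (n : nat) (E : hessian_equation R n) (a0 a1 : R).
Implicit Types (z : phase R n) (y : 'rV[R]_n).

Let Q u : R := u ^+ 2 + a1 * u + a0.

Lemma position_derive z w i :
  is_derive z w (fun z : 'rV[R]_n * 'rV[R]_n => z.1 0 i) (w.1 0 i).
Proof.
have lin : linear (fun z : 'rV[R]_n * 'rV[R]_n => z.1 0 i : R).
  by move=> k [z1 z2] [w1 w2]; rewrite /= !mxE.
pose f : {linear ('rV[R]_n * 'rV[R]_n)%type -> R} :=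
  HB.pack (fun z : 'rV[R]_n * 'rV[R]_n => z.1 0 i : R)
    (GRing.isLinear.Build _ _ _ _ _ lin).
apply: (is_derive_linear z w (f := f)) => u.
by apply: (@continuous_comp _ _ _ fst (fun y : 'rV[R]_n => y 0 i));
  [exact: cvg_fst|exact: coord_continuous].
Qed.

Lemma velocity_derive z w i :
  is_derive z w (fun z : 'rV[R]_n * 'rV[R]_n => z.2 0 i) (w.2 0 i).
Proof.
have lin : linear (fun z : 'rV[R]_n * 'rV[R]_n => z.2 0 i : R).
  by move=> k [z1 z2] [w1 w2]; rewrite /= !mxE.
pose f : {linear ('rV[R]_n * 'rV[R]_n)%type -> R} :=
  HB.pack (fun z : 'rV[R]_n * 'rV[R]_n => z.2 0 i : R)
    (GRing.isLinear.Build _ _ _ _ _ lin).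
apply: (is_derive_linear z w (f := f)) => u.
by apply: (@continuous_comp _ _ _ snd (fun y : 'rV[R]_n => y 0 i));
  [exact: cvg_snd|exact: coord_continuous].
Qed.

Lemma position_differentiable z i :
  differentiable (fun z : 'rV[R]_n * 'rV[R]_n => z.1 0 i) z.
Proof.
apply: (@differentiable_comp _ _ _ _ fst (fun y : 'rV[R]_n => y 0 i)).
  have lin : linear (@fst 'rV[R]_n 'rV[R]_n) by move=> k [z1 z2] [w1 w2].
  pose f : {linear ('rV[R]_n * 'rV[R]_n)%type -> 'rV[R]_n} :=
    HB.pack (@fst 'rV[R]_n 'rV[R]_n) (GRing.isLinear.Build _ _ _ _ _ lin).
  by apply: (@linear_differentiable _ _ _ f) => u; exact: cvg_fst.
exact: differentiable_coord.
Qed.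

Lemma velocity_differentiable z i :
  differentiable (fun z : 'rV[R]_n * 'rV[R]_n => z.2 0 i) z.
Proof.
apply: (@differentiable_comp _ _ _ _ snd (fun y : 'rV[R]_n => y 0 i)).
  have lin : linear (@snd 'rV[R]_n 'rV[R]_n) by move=> k [z1 z2] [w1 w2].
  pose f : {linear ('rV[R]_n * 'rV[R]_n)%type -> 'rV[R]_n} :=
    HB.pack (@snd 'rV[R]_n 'rV[R]_n) (GRing.isLinear.Build _ _ _ _ _ lin).
  by apply: (@linear_differentiable _ _ _ f) => u; exact: cvg_snd.
exact: differentiable_coord.
Qed.

Lemma F2_over_prodE : F2_over_prod E = fun z =>
  (sigsum (coef E) 0 [set: 'I_n]%SET (z.1 0) *
     sigsum (coef E) 0 [set: 'I_n]%SET (z.1 0)) / \prod_i z.2 0 i.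
Proof. by apply/funext => z; rewrite /F2_over_prod hess_FE expr2. Qed.

Lemma F2_over_prod_differentiable z : regular E z ->
  differentiable (F2_over_prod E) z.
Proof.
move=> [q0 F0]; rewrite F2_over_prodE.
have FD := differentiable_sigsum (coef E) [set: 'I_n]%SET 0 (position_differentiable z).
have PD := differentiable_prod (index_enum 'I_n) (velocity_differentiable z).
apply: differentiableM; first exact: differentiableM.
apply: differentiableV; first exact: PD.
by apply/prodf_neq0 => i _.
Qed.

Lemma xi_differentiable i z : z.2 0 i != 0 -> differentiable (xi a0 a1 i) z.
Proof.
move=> q0; have pD := position_differentiable z i.
have qD := velocity_differentiable z i.
rewrite (_ : xi a0 a1 i = (fun z : 'rV[R]_n * 'rV[R]_n =>
    (z.1 0 i * z.1 0 i + cst a1 z * z.1 0 i + cst a0 z) / z.2 0 i)); last first.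
  by apply/funext => u; rewrite /xi expr2.
apply: differentiableM; last exact: differentiableV.
apply: differentiableD; last exact: differentiable_cst.
apply: differentiableD; apply: differentiableM => //.
Qed.

(** Velocity directions suffice for independence, and along them [F] is constant. *)
Lemma F2_over_prod_velocity_derive z y : regular E z ->
  'D_((0, y) : 'rV[R]_n * 'rV[R]_n) (F2_over_prod E) z =
  - F2_over_prod E z * \sum_i y 0 i / z.2 0 i.
Proof.
move=> [q0 F0]; rewrite F2_over_prodE.
have P0 : \prod_i z.2 0 i != 0 by apply/prodf_neq0 => i _.
have FD := @is_derive_sigsum R _ n (coef E) (fun z : 'rV[R]_n * 'rV[R]_n => z.1 0)
  _ z (0, y) [set: 'I_n]%SET 0 (position_derive z (0, y)).
have {}FD : is_derive z ((0, y) : 'rV[R]_n * 'rV[R]_n)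
    (fun z : 'rV[R]_n * 'rV[R]_n => sigsum (coef E) 0 [set: 'I_n]%SET (z.1 0)) 0.
  by apply: is_derive_eq FD _; rewrite big1 // => i _; rewrite mxE mul0r.
have PD := is_derive_prod (index_enum 'I_n) (velocity_derive z (0, y)) q0.
have /@derive_val -> := is_derive_div P0 (is_deriveM FD FD) PD.
rewrite /GRing.scale /= !fctE.
set F := sigsum _ _ _ _; set P := \prod_(i <- _) _; set S := \sum_(i <- _) _.
by field.
Qed.

Lemma xi_velocity_derive z y i : z.2 0 i != 0 ->
  'D_((0, y) : 'rV[R]_n * 'rV[R]_n) (xi a0 a1 i) z =
  - Q (z.1 0 i) * y 0 i / z.2 0 i ^+ 2.
Proof.
move=> q0.
have pD := position_derive z (0, y) i; have qD := velocity_derive z (0, y) i.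
rewrite (_ : xi a0 a1 i = (fun z : 'rV[R]_n * 'rV[R]_n =>
    (z.1 0 i * z.1 0 i + (cst a1 z * z.1 0 i + cst a0 z)) / z.2 0 i)); last first.
  by apply/funext => u; rewrite /xi expr2 addrA.
have ND := is_deriveD (is_deriveM pD pD)
  (is_deriveD (is_deriveM (is_derive_cst a1 z (0, y)) pD) (is_derive_cst a0 z (0, y))).
have /@derive_val -> := is_derive_div q0 ND qD.
rewrite /GRing.scale /= !fctE mxE /Q; by field.
Qed.

Lemma near_dnbhs_neq (c : R) : \forall t \near (0 : R)^', t != c.
Proof.
have [->|c0] := eqVneq c 0; first exact: nbhs_dnbhs_neq.
apply: nbhs_dnbhs; apply: open_nbhs_nbhs; split; first exact: open_neq.
by rewrite /= eq_sym.
Qed.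

(** If [Q u] is zero, [Q (u + t)] factors as [t * (t + (2 * u + a1))]; otherwise continuity
    suffices. *)
Lemma near_dnbhs_quadratic_neq0 (u : R) : \forall t \near (0 : R)^', Q (u + t) != 0.
Proof.
have [Qu|Qu] := eqVneq (Q u) 0.
  have := near_dnbhs_neq 0; apply: filterS2 (near_dnbhs_neq (- (2 * u + a1))).
  move=> t t1 t2; have -> : Q (u + t) = t * (t + (2 * u + a1)).
    by rewrite -[LHS]subr0 -Qu /Q; ring.
  by rewrite mulf_neq0 // addr_eq0.
apply: nbhs_dnbhs.
have Qc : {for 0, continuous (fun t => Q (u + t))}.
  have D1 := is_deriveD (is_derive_cst u (0 : R) (1 : R)) (is_derive_id (0 : R) (1 : R)).
  have := is_derive_continuous (is_deriveD (is_deriveD (is_deriveM D1 D1)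
    (is_deriveM (is_derive_cst a1 (0 : R) (1 : R)) D1)) (is_derive_cst a0 (0 : R) (1 : R))).
  by rewrite (_ : (fun t => Q (u + t)) = (cst u + id) * (cst u + id) +
    cst a1 * (cst u + id) + cst a0) //.
by apply: (Qc [set v | v != 0]); apply: open_nbhs_nbhs; split;
  [exact: open_neq|rewrite /= addr0].
Qed.

(** All positions are first moved by a common small [t], which makes every [Q] nonzero; then one
    velocity is moved by [u], on which the sum depends affinely with nonzero slope. *)
Lemma regular_generic z e (i0 : 'I_n) : regular E z -> 0 < e ->
  exists z', [/\ regular E z', ball z e z', forall i, Q (z'.1 0 i) != 0 &
    \sum_i z'.2 0 i / Q (z'.1 0 i) != 0].
Proof.
move=> [q0 F0] e0.
have small : \forall t \near (0 : R)^', `|t| < e.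
  apply: nbhs_dnbhs; apply/nbhs_ballP; exists e => // t.
  by rewrite /ball /= sub0r normrN.
have Fnear : \forall t \near (0 : R)^', hess_F E (z.1 + const_mx t) != 0.
  apply: nbhs_dnbhs.
  have D1 i : is_derive (0 : R) 1 (fun t : R => z.1 0 i + t) 1.
    apply: is_derive_eq (is_deriveD (is_derive_cst (z.1 0 i) (0 : R) (1 : R))
      (is_derive_id (0 : R) (1 : R))) _.
    by rewrite add0r.
  have := is_derive_continuous (is_derive_sigsum (coef E) [set: 'I_n]%SET 0 D1).
  move=> /(_ [set v | v != 0]) H.
  have : \forall t \near (0 : R),
      sigsum (coef E) 0 [set: 'I_n]%SET (fun i => z.1 0 i + t) != 0.
    apply: H; apply: open_nbhs_nbhs; split; first exact: open_neq.
    rewrite /=; move: F0; rewrite hess_FE; congr (sigsum _ _ _ _ != 0).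
    by apply/funext => i; rewrite addr0.
  apply: filterS => t; rewrite hess_FE; congr (sigsum _ _ _ _ != 0).
  by apply/funext => i; rewrite !mxE.
have Qnear : \forall t \near (0 : R)^', forall i, Q (z.1 0 i + t) != 0.
  by apply: filter_forall => i; exact: near_dnbhs_quadratic_neq0.
have [t [[te Ft] Qt]] := filter_ex (filterI (filterI small Fnear) Qnear).
pose S := \sum_i z.2 0 i / Q (z.1 0 i + t).
(* The two excluded values are those at which the velocity [i0] or the sum would vanish. *)
have [u [[ue uq] uS]] := filter_ex (filterI (filterI small
  (near_dnbhs_neq (- z.2 0 i0))) (near_dnbhs_neq (- (S * Q (z.1 0 i0 + t))))).
exists (z.1 + const_mx t, z.2 + u *: delta_mx 0 i0); split.
- split => [i /=|]; last exact: Ft.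
  rewrite !mxE /=; have [->|] := eqVneq i i0.
    by rewrite mulr1 addrC addr_eq0.
  by rewrite mulr0 addr0.
- split; split=> // i j; rewrite !mxE /ball /= opprD addrA subrr sub0r normrN //.
  by case: (_ && _); rewrite ?mulr1 ?mulr0 ?normr0.
- by move=> i; rewrite !mxE.
- rewrite (bigD1 i0) //= !mxE !eqxx mulr1.
  rewrite (eq_bigr (fun i => z.2 0 i / Q (z.1 0 i + t))); last first.
    by move=> i /negbTE ii0; rewrite !mxE ii0 mulr0 addr0.
  rewrite mulrDl addrAC -(bigD1 i0 (P := xpredT) (F := fun i => z.2 0 i / Q (z.1 0 i + t))) //=.
  rewrite -/S; apply: contraNneq uS => /eqP.
  rewrite addr_eq0 => /eqP ->; rewrite mulNr opprK divfK //.
Qed.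

End PhaseSpace.

Section Independence.
Variables (R : realType) (n : nat) (E : hessian_equation R n) (a0 a1 : R).
Variable i0 : 'I_n.

(** The slot [i0], where the difference of the [xi] would be identically zero, holds the remaining
    integral. *)
Definition integrals (k : 'I_n) : phase R n -> R :=
  if k == i0 then F2_over_prod E
  else fun z => xi a0 a1 k z - xi a0 a1 i0 z.

(* In the direction [(0, y)] with [y_i = p_i'^2 / Q(p_i)] all the [xi_i] vary at
   the same rate, so only [F^2 / prod p_i'] varies among the integrals. *)
Lemma integrals_independent : functionally_independent E integrals.
Proof.
move=> z e zreg e0.
have [z' [z'reg zz' Q0 S0]] := @regular_generic R n E a0 a1 z e i0 zreg e0.
have [q0 F0] := z'reg.
have xiD k : differentiable (xi a0 a1 k) z' by exact: xi_differentiable.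
have intD k : differentiable (integrals k) z'.
  rewrite /integrals; case: ifP => _; first exact: F2_over_prod_differentiable.
  by apply: differentiableB; exact: xiD.
exists z'; split=> // lam lam0.
have lamE (y : 'rV[R]_n) : lam i0 * (- F2_over_prod E z' * \sum_i y 0 i / z'.2 0 i)
    + \sum_(k | k != i0) lam k *
      (- (z'.1 0 k ^+ 2 + a1 * z'.1 0 k + a0) * y 0 k / z'.2 0 k ^+ 2
       + (z'.1 0 i0 ^+ 2 + a1 * z'.1 0 i0 + a0) * y 0 i0 / z'.2 0 i0 ^+ 2) = 0.
  rewrite -[RHS](lam0 (0, y)) [RHS](bigD1 i0) //=; congr (_ + _).
    by rewrite /integrals eqxx F2_over_prod_velocity_derive.
  apply: eq_bigr => k /negbTE ki0; rewrite /integrals ki0; congr (_ * _).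
  have D' l : derivable (xi a0 a1 l) z' ((0, y) : 'rV[R]_n * 'rV[R]_n).
    exact: diff_derivable (xiD l).
  rewrite (deriveB (D' k) (D' i0)) !xi_velocity_derive //.
  by rewrite [- _ * y 0 i0]mulNr [- _ / z'.2 0 i0 ^+ 2]mulNr opprK.
have Phi0 : F2_over_prod E z' != 0.
  rewrite /F2_over_prod mulf_neq0 ?expf_neq0 // invr_neq0 //.
  by apply/prodf_neq0 => i _.
have lami0 : lam i0 = 0.
  have := lamE (\row_i (z'.2 0 i ^+ 2 / (z'.1 0 i ^+ 2 + a1 * z'.1 0 i + a0))).
  rewrite [X in _ + X]big1 ?addr0; last first.
    move=> k _; rewrite !mxE; apply/eqP; rewrite mulf_eq0; apply/orP; right.
    by apply/eqP; field; rewrite !Q0 !q0.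
  rewrite (eq_bigr (fun i => z'.2 0 i / (z'.1 0 i ^+ 2 + a1 * z'.1 0 i + a0))).
    move/eqP; rewrite mulf_eq0 => /orP[/eqP//|].
    by rewrite mulf_eq0 oppr_eq0 (negbTE Phi0) (negbTE S0).
  by move=> i _; rewrite mxE; field; rewrite Q0 q0.
move=> k; have [->//|ki0] := eqVneq k i0.
(* With [lam i0] gone, varying only the velocity [k] isolates [lam k], with a coefficient that is
   nonzero because [Q] is. *)
have := lamE (delta_mx 0 k); rewrite lami0 mul0r add0r (bigD1 k) //= big1.
  rewrite !mxE !eqxx /= [i0 == k]eq_sym (negbTE ki0) mulr0 mul0r !addr0 mulr1.
  move/eqP; rewrite mulf_eq0 => /orP[/eqP//|].
  by rewrite mulf_eq0 oppr_eq0 (negbTE (Q0 k)) invr_eq0 expf_eq0 /= (negbTE (q0 k)).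
move=> l /andP[_ lk]; rewrite !mxE /= (negbTE lk) [i0 == k]eq_sym (negbTE ki0).
by rewrite !mulr0 !mul0r addr0 mulr0.
Qed.

End Independence.

Unset Implicit Arguments.
Set Strict Implicit.
Set Printing Implicit Defensive.

Theorem theorem1p2 (R : realType) (n : nat) (hn : (0 < n)%N) (a0 a1 : R)
    (E : hessian_equation R n) (hE : recursive_type E a0 a1) :
  completely_integrable E /\
  first_integral E (F2_over_prod E) /\
  (forall i : 'I_n, i != Ordinal hn ->
     first_integral E (fun z => xi a0 a1 i z - xi a0 a1 (Ordinal hn) z)) /\
  (forall D p r, regular_solution E D p r ->
     exists C : R,
       (forall s, D s -> F2_over_prod E (state p s) = C) /\
       forall (i : 'I_n) (s : R), D s ->
         derivable (fun t => xi a0 a1 i (state p t)) s 1 /\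
         derive1 (fun t => xi a0 a1 i (state p t)) s ^+ 2
           = k1 a0 a1
             + k2 a0 a1 (hess_coef E (n%:Z - 1)) (hess_coef E n%:Z) / C
               * \prod_j xi a0 a1 j (state p s)).
Proof.
have FI : first_integral E (F2_over_prod E).
  by move=> D p r sol s t Ds Dt; exact: (F2_over_prod_constant sol Ds Dt).
have XI i k : first_integral E (fun z => xi a0 a1 i z - xi a0 a1 k z).
  by move=> D p r sol s t Ds Dt; exact: (xi_difference_constant sol hE i k Ds Dt).
split; [split|split; [exact: FI|split; [by move=> i _; exact: XI|]]].
- exists (integrals E a0 a1 (Ordinal hn)); split; last exact: integrals_independent.
  by move=> k; rewrite /integrals; case: ifP => _; [exact: FI|exact: XI].
- move=> D p r sol s e Ds e0; exact: (solution_by_quadratures sol hE (Ordinal hn) Ds e0).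
(* On an empty [D] any [C] will do; otherwise [C] is the value of the integral at a chosen time. *)
- move=> D p r sol; have [->|/set0P[s0 Ds0]] := eqVneq D classical_sets.set0.
    by exists 0; split=> [s []|i s []].
  exists (F2_over_prod E (state p s0)); split=> [s Ds|i s Ds].
    exact: (F2_over_prod_constant sol Ds Ds0).
  have xiD := xi_derive a0 a1 sol i Ds.
  split; first by case: xiD.
  rewrite derive1E (@derive_val _ _ _ _ _ _ _ xiD) (xi_slope_equation sol hE i Ds).
  by rewrite (F2_over_prod_constant sol Ds Ds0).
Qed.
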